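(* Let $d$ be a fixed even integer with $d\ge 4$, and let $\mathsf{FC}_d(n)$ denote the facet hypergraph of the $d$-dimensional cyclic polytope on $n$ vertices (defined in the context). Then, as $n\to\infty$: (1) $\chi_{CF}(\mathsf{FC}_d(n))=\Omega(\sqrt{n})$ for every even $d\ge 4$; (2) for every positive integer $k$ and $d=4k$, $\chi_{CF}(\mathsf{FC}_d(n))=\Omega(n^{\frac{d}{d+4}})=\Omega(n^{\frac{k}{k+1}})$; (3) for every even $d\ge 14$ with $d/2$ odd, $\chi_{CF}(\mathsf{FC}_d(n))=\Omega(n^{\frac{k^*}{k^*+1}})$, where $k^*=\lfloor d/6\rfloor$.
   Context: A hypergraph is a pair $(V,\mathcal{E})$ with $\mathcal{E}\subseteq 2^V$. A conflict-free coloring (CF-coloring) of a hypergraph is a map $\varphi$ on $V$ such that every nonempty hyperedge $e$ contains a vertex $x$ with $\varphi(y)\ne\varphi(x)$ for all $y\in e\setminus\{x\}$; $\chi_{CF}(H)$ is the least number of colors in a CF-coloring of $H$. For $n\ge d+1$, $\mathsf{C}_d(n)$ is the convex hull of $\gamma_d(1),\dots,\gamma_d(n)$ where $\gamma_d(t)=(t,t^2,\dots,t^d)$, and we identify $\gamma_d(i)$ with $i\in[n]$. $\mathsf{FC}_d(n)$ is the $d$-uniform hypergraph on $[n]$ whose hyperedges are the vertex sets of facets of $\mathsf{C}_d(n)$. Equivalently (Gale's evenness criterion), a $d$-subset $S\subseteq[n]$ is a hyperedge iff for all $i,j\in[n]\setminus S$ the set $\{k\in S: i<k<j\}$ has even size.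 Asymptotic notation is in $n$ with $d$ fixed. *)

(* Defs.v *)
From mathcomp Require Import all_boot all_order all_algebra.
From mathcomp Require Import all_classical all_reals all_analysis.

Set Implicit Arguments.
Unset Strict Implicit.
Unset Printing Implicit Defensive.

Import Order.TTheory GRing.Theory Num.Theory.
Import numFieldNormedType.Exports.

Local Open Scope classical_set_scope.
Local Open Scope ring_scope.

Definition cf_coloring (V : finType) (E : set {set V}) (C : Type)
    (phi : V -> C) : Prop :=
  forall e : {set V}, E e -> e != finset.set0 ->
    exists2 x : V, x \in e & forall y : V, y \in e -> y != x -> phi y <> phi x.

Lemma cf_colorable_card (V : finType) (E : set {set V}) :
  exists k : nat, `[< exists phi : V -> 'I_k, cf_coloring E phi >].
Proof.
exists #|V|; apply/asboolP; exists enum_rank => e _ /set0Pn[x xe].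
by exists x => // y _ /eqP yx /enum_rank_inj.
Qed.

Definition cf_chromatic_number (V : finType) (E : set {set V}) : nat :=
  ex_minn (cf_colorable_card E).

Section Polytopes.
Variables (R : realType) (d : nat).
Implicit Types (P F : set 'rV[R]_d) (v : 'rV[R]_d).

Definition convex_hull (A : set 'rV[R]_d) : set 'rV[R]_d :=
  smallest (fun B : set (convex_lmodType 'rV[R]_d) => convex_set B) A.

Definition aff_indep (m : nat) (p : 'I_m.+1 -> 'rV[R]_d) : Prop :=
  row_free (\matrix_(i < m) (p (lift ord0 i) - p ord0)).

(* Dimension of the affine hull; no [m] qualifies when the set is empty. *)
Definition has_aff_dim (A : set 'rV[R]_d) (m : nat) : Prop :=
  (exists p : 'I_m.+1 -> 'rV[R]_d, (forall i, A (p i)) /\ aff_indep p) /\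
  ~ (exists p : 'I_m.+2 -> 'rV[R]_d, (forall i, A (p i)) /\ aff_indep p).

(* The normal vector [a] may be zero, so [P] and [set0] count as faces. *)
Definition is_face P F : Prop :=
  exists (a : 'rV[R]_d) (b : R),
    (forall x, P x -> (x *m a^T) 0 0 <= b) /\
    F = [set x | P x /\ (x *m a^T) 0 0 = b].

Definition is_facet P F : Prop :=
  is_face P F /\ exists m, has_aff_dim P m.+1 /\ has_aff_dim F m.

Definition vertices P : set 'rV[R]_d := [set v | is_face P [set v]].

Definition moment_curve (t : R) : 'rV[R]_d := \row_(j < d) t ^+ j.+1.

(* The index [i : 'I_n] stands for the element i + 1 of {1, ..., n}. *)
Definition cyclic_vertex (n : nat) (i : 'I_n) : 'rV[R]_d :=
  moment_curve i.+1%:R.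

Definition cyclic_polytope (n : nat) : set 'rV[R]_d :=
  convex_hull (range (@cyclic_vertex n)).

Definition facet_hypergraph (n : nat) : set {set 'I_n} :=
  [set S | exists2 F, is_facet (cyclic_polytope n) F &
           vertices F = @cyclic_vertex n @` [set` S]].

End Polytopes.

Arguments facet_hypergraph : clear implicits.

Definition chi_FC (R : realType) (d n : nat) : nat :=
  cf_chromatic_number (facet_hypergraph R d n).

(* Main.v *)
(* Cut [n] into consecutive pairs.  A colouring with c colours turns each pair into an edge, from the
   colour of its first point to the colour of its second, of a bipartite multigraph on two copies of
   the colour set.  By Gale's criterion any d/2 of the pairs form a facet, and the facet has no
   uniquely coloured point as soon as the corresponding subgraph has no vertex of degree one.  So it
   suffices to find a subgraph with exactly m = d/2 edges and no vertex of degree one in any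
   multigraph with at least C c^(1 + 1/k) edges, where m = 2k, or m is arbitrary and m >= 3k.

   As in the Bondy-Simonovits theorem, take a breadth-first search tree in a subgraph of large minimum
   degree.  The levels cannot grow by a factor c^(1/k) for k steps, so the bipartite graph between
   some two consecutive levels is dense.  In it one finds a trail whose ends (and, to handle odd m,
   one further vertex) have pairwise distinct ancestors up to a common ancestor exactly h levels up;
   the tree paths to that ancestor complete the trail to the wanted subgraph.  A trail, rather than a
   path, is enough because only degrees matter, and its length can be adjusted so as to obtain exactly
   m edges. *)
From mathcomp Require Import all_boot zify.

Set Implicit Arguments.
Unset Strict Implicit.
Unset Printing Implicit Defensive.

(** * Dense bipartite multigraphs with nested classes on one side *)

Section DenseBipartite.
Variables (E X Y : finType) (x : E -> X) (y : E -> Y).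
Implicit Types A B F S : {set E}.

Lemma card_le_fibers (T : finType) (f : E -> T) (A : {set E}) (N : nat) :
  (forall v, #|[set e in A | f e == v]| <= N) -> #|A| <= N * #|f @: A|.
Proof.
move=> fN; rewrite -sum1_card (partition_big_imset f) /= mulnC -sum_nat_const.
by apply: leq_sum => v _; rewrite sum1_card -cardsE; exact: fN.
Qed.

(** Fewer than [D] edges go while the image of [f] loses a point, so the density bound survives.
    Both images being nonempty, [A] has at least [2 * D] edges and some remain. *)
Lemma delete_fiber (T T' : finType) (f : E -> T) (g : E -> T') A e D :
  e \in A -> D * (#|f @: A| + #|g @: A|) <= #|A| ->
  #|[set e' in A | f e' == f e]| < D ->
  exists A', [/\ A' \proper A, A' != set0 &
    D * (#|f @: A'| + #|g @: A'|) <= #|A'|].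
Proof.
move=> eA le_A lt_D; pose A' := [set e' in A | f e' != f e].
have cardA : #|A| = #|[set e' in A | f e' == f e]| + #|A'|.
  rewrite -(cardsID [set e' | f e' == f e] A); congr (_ + _).
    by apply: eq_card => e'; rewrite !inE.
  by apply: eq_card => e'; rewrite !inE andbC.
have sub : A' \subset A by apply/subsetP => e'; rewrite inE => /andP[].
have fA : #|f @: A'| < #|f @: A|.
  apply: proper_card; rewrite properE imsetS //=.
  apply/negP => /subsetP/(_ _ (imset_f f eA))/imsetP[e'].
  by rewrite inE => /andP[_ /eqP ne] /esym.
have gA : #|g @: A'| <= #|g @: A| by rewrite subset_leq_card // imsetS.
have g0 : 0 < #|g @: A| by apply/card_gt0P; exists (g e); exact: imset_f.
exists A'; split; last by nia.
- rewrite properE sub; apply/negP => /subsetP/(_ _ eA).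
  by rewrite inE eqxx andbF.
- by rewrite -card_gt0; nia.
Qed.

Lemma min_degree_core A D :
  A != set0 -> D * (#|x @: A| + #|y @: A|) <= #|A| ->
  exists B, [/\ B \subset A, B != set0 & forall e, e \in B ->
    D <= #|[set e' in B | x e' == x e]| /\ D <= #|[set e' in B | y e' == y e]|].
Proof.
have [N] := ubnP #|A|; elim: N A => // N IH A /ltnSE le_N A0 le_A.
have recurse A' : A' \proper A -> A' != set0 ->
    D * (#|x @: A'| + #|y @: A'|) <= #|A'| ->
  exists B, [/\ B \subset A, B != set0 & forall e, e \in B ->
    D <= #|[set e' in B | x e' == x e]| /\ D <= #|[set e' in B | y e' == y e]|].
  move=> pA A'0 leA'.
  have [|B [sB B0 dB]] := IH A' _ A'0 leA'.
    exact: leq_trans (proper_card pA) le_N.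
  by exists B; split=> //; exact: subset_trans sB (proper_sub pA).
have [/exists_inP[e eA bad]|ok] := boolP [exists e in A,
    (#|[set e' in A | x e' == x e]| < D) || (#|[set e' in A | y e' == y e]| < D)].
  case/orP: bad => bad.
    by have [A' [pA A'0 leA']] := delete_fiber eA le_A bad; exact: (recurse A').
  rewrite addnC in le_A.
  have [A' [pA A'0 leA']] := delete_fiber eA le_A bad.
  by apply: (recurse A') => //; rewrite addnC.
exists A; split=> // e eA; apply/andP.
rewrite leqNgt [X in _ && X]leqNgt -negb_or.
by apply: contraNN ok => bad; apply/exists_inP; exists e.
Qed.

Lemma even_trail (T : eqType) (cl : X -> T) t B D e0 :
  e0 \in B -> cl (x e0) = t ->
  (forall e e', e \in B -> e' \in B -> y e = y e' -> cl (x e) = cl (x e')) ->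
  (forall e, e \in B ->
    D <= #|[set e' in B | x e' == x e]| /\ D <= #|[set e' in B | y e' == y e]|) ->
  forall j, j.*2 <= D -> exists S e1 e2,
  [/\ S \subset B /\ #|S| = j.*2,
      e1 \in B /\ e2 \in B,
      cl (x e1) = t /\ cl (x e2) = t,
      forall e, e \in S -> [/\ cl (x e) = t,
        exists e', [/\ e' \in S, e' != e & x e' = x e] &
        [\/ y e = y e1, y e = y e2 |
          exists e', [/\ e' \in S, e' != e & y e' = y e]]]
    & y e1 != y e2 -> y e1 \in y @: S /\ y e2 \in y @: S].
Proof.
move=> e0B te0 clB degB; elim=> [|j IH] leD.
  exists set0, e0, e0; split=> //; rewrite ?sub0set ?cards0 ?eqxx //.
  by move=> e; rewrite inE.
have [|S [e1 [e2 [[SB cS] [e1B e2B] [t1 t2] inS ends]]]] := IH.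
  by apply: leq_trans leD; rewrite leq_double.
have fresh (T' : finType) (f : E -> T') S' v : #|S'| < D ->
    D <= #|[set e' in B | f e' == v]| ->
    exists2 e, e \in B & f e = v /\ e \notin S'.
  move=> lt_S' le_D.
  have /subsetPn[e] : ~~ ([set e' in B | f e' == v] \subset S').
    by apply: contraL lt_S' => /subset_leq_card le_S'; rewrite -leqNgt (leq_trans le_D).
  by rewrite inE => /andP[eB /eqP fe] eS'; exists e.
have [||a aB [ya aS]] := fresh _ y S (y e2).
- by rewrite cS; apply: leq_trans leD; rewrite doubleS.
- exact: (degB e2 e2B).2.

have [||b bB [xb]] := fresh _ x (a |: S) (x a).
- by rewrite cardsU1 aS cS; apply: leq_trans leD; rewrite doubleS.
- exact: (degB a aB).1.
rewrite !inE negb_or => /andP[ba bS].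
have ta : cl (x a) = t by rewrite -t2; apply: clB.
have aI : a \in b |: (a |: S) by rewrite !inE eqxx orbT.
have bI : b \in b |: (a |: S) by rewrite !inE eqxx.
have SI e : e \in S -> e \in b |: (a |: S) by rewrite !inE => ->; rewrite !orbT.
have neS c e : c \notin S -> e \in S -> c != e.
  by move=> cS' eS; apply: contraNneq cS' => ->.
have e2S : y e1 != y e2 -> exists2 e, e \in S & y e = y e2.
  by move=> /ends[_ /imsetP[e eS ->]]; exists e.
exists (b |: (a |: S)), e1, b; split=> //.
- rewrite !subUset !sub1set aB bB SB; split=> //.
  by rewrite !cardsU1 !inE negb_or ba bS aS cS doubleS.
- by rewrite xb.
- move=> e; rewrite !inE => /or3P[/eqP->|/eqP->|eS].
  + by split; [rewrite xb | exists a; rewrite eq_sym | constructor 2].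
  + split=> //; first by exists b.
    have [e12|/e2S[g gS yg]] := eqVneq (y e1) (y e2); first by constructor 1; rewrite ya.
    constructor 3; exists g; rewrite yg ya; split=> //; first exact: SI.
    by rewrite eq_sym; exact: neS.
  + have [te [e' [e'S ne xe]] ye] := inS _ eS; split=> //.
      by exists e'; split=> //; exact: SI.
    case: ye => [ye|ye|[e'' [e''S ne' ye]]].
    * by constructor 1.
    * by constructor 3; exists a; split=> //; [exact: neS | rewrite ya ye].
    * by constructor 3; exists e''; split=> //; exact: SI.
- move=> ne; split; last by apply/imsetP; exists b.
  have [e12|/ends[/imsetP[e eS ->] _]] := eqVneq (y e1) (y e2).
    by apply/imsetP; exists a => //; rewrite ya.
  by apply/imsetP; exists e => //; exact: SI.
Qed.

Variables (T : finType) (cl : nat -> X -> T) (p m : nat).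
Hypothesis cl0_inj : injective (cl 0).
(** [p] is the number of marked vertices when there are any. With two of them the trail joins two
    [x]-vertices and has even length, which forces [m] to be even; a third one makes both parities
    available. *)
Hypothesis pm : (p == 2) && ~~ odd m || (p == 3).
Hypothesis m1 : 1 < m.

(* Data from which a subgraph with [m] edges and no vertex of degree one is obtained by joining each
   marked vertex of [W] to its common ancestor, [h] levels up, by a path of length [h]; [cl i v] is
   the [i]-th ancestor of [v].  For [W] empty, [F] itself is the subgraph. *)
Definition layer_config A H := exists h F (W : {set X}),
  [/\ h <= H /\ F \subset A,
      #|F| + #|W| * h = m,
      {in W &, forall a b, cl h a = cl h b} /\ {in W &, injective (cl h.-1)},
      [/\ W != set0 -> 0 < h, #|W| != 1 & W \subset x @: F] &
      forall e, e \in F ->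
        (exists e', [/\ e' \in F, e' != e & y e' = y e]) /\
        (x e \in W \/ exists e', [/\ e' \in F, e' != e & x e' = x e])].

Lemma layer_configS A A' H H' :
  A \subset A' -> H <= H' -> layer_config A H -> layer_config A' H'.
Proof.
move=> sA le_H [h [F [W [[hH FA] rest1 rest2 rest3 rest4]]]].
exists h, F, W; split=> //; split; [exact: leq_trans hH le_H|].
exact: subset_trans FA sA.
Qed.

Definition classes_at H A v := [set cl H (x e) | e in A & y e == v].

Lemma rich_edge H A v (Z : {set T}) : #|Z| < #|classes_at H A v| ->
  exists e, [/\ e \in A, y e = v & cl H (x e) \notin Z].
Proof.
move=> ltZ; have /subsetPn[c /imsetP[e]] : ~~ (classes_at H A v \subset Z).
  by apply/negP => /subset_leq_card; lia.
by rewrite inE => /andP[eA /eqP ye] {c}-> ceZ; exists e.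
Qed.

(** Keep at each [y]-vertex only the edges of its most popular class: with at most [K] classes
    there, at least one edge in [K] survives. *)
Lemma poor_config H A K D :
  A != set0 -> (forall e, e \in A -> #|classes_at H A (y e)| <= K) ->
  K * D * (#|x @: A| + #|y @: A|) <= #|A| ->
  exists A', [/\ A' \subset A, A' != set0,
    {in A' &, forall e e', y e = y e' -> cl H (x e) = cl H (x e')} &
    D * (#|x @: A'| + #|y @: A'|) <= #|A'|].
Proof.
move=> A0 poor le_A; have /set0Pn[e0 e0A] := A0.
pose N v c := #|[set e in A | (y e == v) && (cl H (x e) == c)]|.
pose top v := [arg max_(c > cl H (x e0)) N v c].
have topP v c : N v c <= N v (top v) by rewrite /top; case: arg_maxnP => // i _; apply.
pose A' := [set e in A | cl H (x e) == top (y e)].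
have sub : A' \subset A by apply/subsetP => e; rewrite inE => /andP[].
have le_A' : #|A| <= K * #|A'|.
  have fib (B : {set E}) : B \subset A ->
      #|B| = \sum_(v in y @: A) #|[set e in B | y e == v]|.
    move=> BA; rewrite -sum1_card (partition_big y (mem (y @: A))) /=.
      by apply: eq_bigr => v _; rewrite sum1_card -cardsE.
    by move=> e eB; apply: imset_f; exact: (subsetP BA).
  rewrite (fib A) // (fib A') // big_distrr /=; apply: leq_sum => _ /imsetP[e eA ->].
  have -> : #|[set e' in A' | y e' == y e]| = N (y e) (top (y e)).
    apply: eq_card => e'; rewrite !inE -andbA.
    by case: (e' \in A); rewrite //= andbC; case: eqP => // ->.
  pose B := [set e' in A | y e' == y e].
  have -> : [set e' in A | y e' == y e] = B by [].
  have -> : K * N (y e) (top (y e)) = N (y e) (top (y e)) * K by rewrite mulnC.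
  apply: leq_trans (leq_mul (leqnn _) (poor e eA)).
  have -> : classes_at H A (y e) = (cl H \o x) @: B.
    by apply: eq_imset.
  apply: card_le_fibers => c; apply: leq_trans (topP (y e) c).
  by apply: subset_leq_card; apply/subsetP => e'; rewrite !inE -andbA.
have [xA yA] : #|x @: A'| <= #|x @: A| /\ #|y @: A'| <= #|y @: A|.
  by split; rewrite subset_leq_card // imsetS.
have posA : 0 < #|A| by rewrite card_gt0.
exists A'; split=> //.
- by rewrite -card_gt0; case: #|A'| le_A' => //; rewrite muln0 leqNgt posA.
- move=> e e'; rewrite !inE => /andP[_ /eqP->] /andP[_ /eqP->] -> //.
- have K0 : 0 < K by case: (K) le_A' => //; rewrite mul0n leqNgt posA.
  rewrite -(leq_pmul2l K0) mulnA; apply: leq_trans le_A'; apply: leq_trans le_A.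
  by rewrite leq_mul // leq_add.
Qed.

Lemma inj_set2 (U : finType) (U' : eqType) (f : U -> U') a b : f a != f b ->
  {in [set a; b] &, injective f} /\ #|[set a; b]| = 2.
Proof.
move=> ab; split; last by rewrite cards2 (contraNneq _ ab) // => ->.
move=> u v; rewrite !inE => /orP[]/eqP-> /orP[]/eqP-> // /eqP.
  by rewrite (negPf ab).
by rewrite eq_sym (negPf ab).
Qed.

Lemma inj_set3 (U : finType) (U' : eqType) (f : U -> U') a b c :
  f a != f b -> f a != f c -> f b != f c ->
  {in [set a; b; c] &, injective f} /\ #|[set a; b; c]| = 3.
Proof.
move=> ab ac bc; have [_ c2] := inj_set2 ab; split; last first.
  rewrite setUC cardsU1 c2 !inE negb_or.
  by rewrite (contraNneq _ ac) 1?(contraNneq _ bc) // => ->.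
move=> u v; rewrite !inE => /orP[/orP[]|]/eqP-> /orP[/orP[]|]/eqP-> // /eqP;
  by rewrite ?(negPf ab, negPf ac, negPf bc) // eq_sym ?(negPf ab, negPf ac, negPf bc).
Qed.

(* A trail of even length in [B], with one more edge at one end and one or two at the other (one or
   two according to parity): the far ends of these edges, chosen in pairwise distinct classes, are
   marked, and if [p = 3] and only two edges were added, a vertex inside the trail is marked too. *)
Lemma rich_config H A B :
  B \subset A -> B != set0 ->
  {in A &, forall e e', y e = y e' -> cl H.+1 (x e) = cl H.+1 (x e')} ->
  (forall e, e \in B ->
    m <= #|[set e' in B | x e' == x e]| /\ m <= #|[set e' in B | y e' == y e]|) ->
  (forall e, e \in B -> m.+2 < #|classes_at H A (y e)|) ->
  p * H.+2 <= m -> layer_config A H.+1.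
Proof.
move=> BA /set0Pn[e0 e0B] clA degB richB pHm.
(* Of the [m] edges, [p * H.+1] are reserved for the paths to the common ancestor; [f] remain for
   the trail and its end edges. *)
pose t := cl H.+1 (x e0); pose f := m - p * H.+1.
have fE : f + p * H.+1 = m by rewrite subnK // (leq_trans _ pHm) // leq_mul2l leqnSn orbT.
have f_ge : p <= f by rewrite -(leq_add2r (p * H.+1)) fE -mulnS.
have clB : forall e e', e \in B -> e' \in B -> y e = y e' -> cl H.+1 (x e) = cl H.+1 (x e').
  by move=> e e' /(subsetP BA) eA /(subsetP BA); exact: clA.
have trail := even_trail e0B (erefl t) clB degB.
(* [P] collects the edges added at the ends of the trail, [a] at one and [b] at the other. If the
   ends coincide, [a] and [b] meet there; otherwise each meets a trail edge. *)
have key S e1 e2 (P : {set E}) (W : {set X}) a b :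
    S \subset B ->
    (forall e, e \in S -> [/\ cl H.+1 (x e) = t,
        exists e', [/\ e' \in S, e' != e & x e' = x e] &
        [\/ y e = y e1, y e = y e2 |
          exists e', [/\ e' \in S, e' != e & y e' = y e]]]) ->
    (y e1 != y e2 -> y e1 \in y @: S /\ y e2 \in y @: S) ->
    P \subset A -> [disjoint S & P] -> a \in P -> b \in P -> a != b ->
    y a = y e1 -> y b = y e2 ->
    (forall e, e \in P -> (y e = y e1 \/ y e = y e2) /\ x e \in W) ->
    W \subset x @: (S :|: P) -> {in W &, injective (cl H)} ->
    (forall w, w \in W -> cl H.+1 w = t) -> #|W| = p -> #|S| + #|P| = f ->
  layer_config A H.+1.
  move=> SB inS ends PA dSP aP bP ab ya yb inP WF clW tW cW cF.
  have aF : a \in S :|: P by rewrite inE aP orbT.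
  have bF : b \in S :|: P by rewrite inE bP orbT.
  have SF e : e \in S -> e \in S :|: P by rewrite inE => ->.
  have neP e e' : e \in S -> e' \in P -> e != e'.
    by move=> eS; apply: contraTneq => <-; rewrite (disjointFr dSP eS).
  have at1 e : y e = y e1 -> exists e', [/\ e' \in S :|: P, e' != e & y e' = y e].
    move=> ye; have [->|ne] := eqVneq e a; last by exists a; rewrite eq_sym ya.
    have [e12|/ends[/imsetP[g gS yg] _]] := eqVneq (y e1) (y e2).
      by exists b; rewrite eq_sym yb ya.
    by exists g; rewrite ya yg SF // neP.
  have at2 e : y e = y e2 -> exists e', [/\ e' \in S :|: P, e' != e & y e' = y e].
    move=> ye; have [->|ne] := eqVneq e b; last by exists b; rewrite eq_sym yb.
    have [e12|/ends[_ /imsetP[g gS yg]]] := eqVneq (y e1) (y e2).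
      by exists a; rewrite yb ya.
    by exists g; rewrite yb yg SF // neP.
  exists H.+1, (S :|: P), W; split.
  - by split=> //; rewrite subUset PA (subset_trans SB BA).
  - by rewrite cardsU disjoint_setI0 // cards0 subn0 cF cW.
  - by split=> // u v uW vW; rewrite !tW.
  - by split=> //; rewrite cW; case/orP: pm => [/andP[/eqP-> _]|/eqP->].
  - move=> e; rewrite !inE => /orP[eS|eP].
      have [_ [e' [e'S ne xe]] ye] := inS _ eS; split; last first.
        by right; exists e'; split=> //; exact: SF.
      case: ye => [/at1|/at2|[e'' [e''S ne'' ye]]] //.
      by exists e''; split=> //; exact: SF.
    by have [[/at1|/at2] ? ?] := inP _ eP; split=> //; left.
(* An end edge must avoid the classes of the trail and of two earlier choices, fewer than [m.+3] in
   all; hence the threshold for richness. It is sought in [A], where richness is measured, not in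
   [B]. *)
have small S (g h : E) : #|S|.+1 < m ->
    #|cl H (x g) |: (cl H (x h) |: [set cl H (x e) | e in S])| < m.+3.
  move=> Sm; rewrite !cardsU1 ltnS -[m.+2]/(1 + (1 + m)) !leq_add ?leq_b1 //.
  exact: leq_trans (leq_imset_card _ _) (ltnW (ltnW Sm)).
have pick S g h e : #|S|.+1 < m -> e \in B ->
    exists e', [/\ e' \in A, y e' = y e, e' \notin S, cl H (x e') != cl H (x g) &
      cl H (x e') != cl H (x h) /\ forall s, s \in S -> cl H (x e') != cl H (x s)].
  move=> Sm eB; have := leq_trans (small S g h Sm) (richB e eB).
  case/rich_edge => e' [e'A ye']; rewrite !inE !negb_or => /and3P[neg neh neS].
  have neS' s : s \in S -> cl H (x e') != cl H (x s).
    by move=> sS; apply: contraNneq neS => ->; apply: imset_f.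
  exists e'; split=> //; apply/negP => /neS'; by rewrite eqxx.
have tA e e' : e \in A -> e' \in B -> y e = y e' -> cl H.+1 (x e') = t -> cl H.+1 (x e) = t.
  by move=> eA /(subsetP BA) e'A ye <-; exact: clA.
have f_le : f <= m by rewrite leq_subr.
have f2 : 1 < f by apply: leq_trans f_ge; case/orP: pm => [/andP[/eqP-> _]|/eqP->].
have small_card n S : #|S| = f - n.+2 -> #|S|.+1 < m.
  move=> ->; apply: leq_trans f_le; rewrite -[X in _ <= X](subnK f2) addn2 !ltnS.
  exact: leq_sub2l.
have disj S (P : {set E}) : (forall e, e \in P -> e \notin S) -> [disjoint S & P].
  by move=> dP; rewrite disjoint_sym disjoint_subset; apply/subsetP => e /dP.
(* The trail has even length, so an odd [f] takes three end edges, two of them at [y e1]. *)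
have [f_odd|f_even] := boolP (odd f).
  have p3 : p = 3.
    case/orP: pm => [/andP[/eqP p2 m_even]|/eqP//].
    by move: f_odd m_even; rewrite -fE p2 oddD oddM /= addbF => ->.
  have f3 : 3 <= f by rewrite -p3.
  have jE : (f - 3)./2.*2 = f - 3 by rewrite even_halfK // oddB // f_odd.
  have [|S [e1 [e2 [[SB cS] [e1B e2B] [t1 t2] inS ends]]]] := trail (f - 3)./2.
    by rewrite jE (leq_trans (leq_subr _ _)).
  rewrite jE in cS.
  have Sm : #|S|.+1 < m := small_card _ _ cS.
  have [a [aA ya aS _ _]] := pick S e0 e0 e1 Sm e1B.
  have [b [bA yb bS ba _]] := pick S a a e1 Sm e1B.
  have [c [cA yc cS' ca [cb _]]] := pick S a b e2 Sm e2B.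
  rewrite eq_sym in ba; rewrite eq_sym in ca; rewrite eq_sym in cb.
  have [_ cP] := @inj_set3 _ _ (cl H \o x) a b c ba ca cb.
  have [clW cW] := @inj_set3 _ _ (cl H) (x a) (x b) (x c) ba ca cb.
  apply: (key S e1 e2 [set a; b; c] [set x a; x b; x c] a c) => //.
  - by rewrite !subUset !sub1set aA bA.
  - by apply: disj => e; rewrite !inE => /orP[/orP[]|]/eqP->.
  - by rewrite !inE eqxx.
  - by rewrite !inE eqxx !orbT.
  - by apply: contraNneq ca => ->.
  - by move=> e; rewrite !inE => /orP[/orP[]|]/eqP->; rewrite eqxx ?orbT; auto.
  - rewrite !subUset !sub1set -!andbA; apply/and3P; split; apply: imset_f;
      by rewrite !inE eqxx ?orbT.
  - move=> w; rewrite !inE => /orP[/orP[]|]/eqP->.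
    + exact: tA aA e1B ya t1.
    + exact: tA bA e1B yb t1.
    + exact: tA cA e2B yc t2.
  - by rewrite cW p3.
  - by rewrite cS cP subnK.
have jE : (f - 2)./2.*2 = f - 2 by rewrite even_halfK // oddB // (negPf f_even).
have [|S [e1 [e2 [[SB cS] [e1B e2B] [t1 t2] inS ends]]]] := trail (f - 2)./2.
  by rewrite jE (leq_trans (leq_subr _ _)).
rewrite jE in cS.
have Sm : #|S|.+1 < m := small_card _ _ cS.
have [a [aA ya aS _ [_ aSc]]] := pick S e0 e0 e1 Sm e1B.
have [b [bA yb bS ba [_ bSc]]] := pick S a a e2 Sm e2B.
rewrite eq_sym in ba.
have [_ cP] := @inj_set2 _ _ (cl H \o x) a b ba.
have xP e : e \in [set a; b] -> x e \in x @: (S :|: [set a; b]).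
  by move=> eP; apply: imset_f; rewrite inE eP orbT.
have aP : a \in [set a; b] by rewrite !inE eqxx.
have bP : b \in [set a; b] by rewrite !inE eqxx orbT.
have ab : a != b by apply: contraNneq ba => ->.
have ta := tA a e1 aA e1B ya t1.
have tb := tA b e2 bA e2B yb t2.
have PA : [set a; b] \subset A by rewrite subUset !sub1set aA.
have dSP : [disjoint S & [set a; b]].
  by apply: disj => e; rewrite !inE => /orP[]/eqP->.
have cF : #|S| + #|[set a; b]| = f by rewrite cS cP subnK.
case/orP: pm => [/andP[/eqP p2 m_even]|/eqP p3].
  have [clW cW] := @inj_set2 _ _ (cl H) (x a) (x b) ba.
  apply: (key S e1 e2 [set a; b] [set x a; x b] a b) => //.
  - by move=> e; rewrite !inE => /orP[]/eqP->; rewrite eqxx ?orbT; auto.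
  - by rewrite subUset !sub1set !xP.
  - by move=> w; rewrite !inE => /orP[]/eqP->.
  - by rewrite cW p2.
(* With only two end edges, the third marked vertex is taken on the trail, which is nonempty because
   [f] is at least three. *)
have [g gS] : exists g, g \in S.
  apply/set0Pn; rewrite -card_gt0 cS subn_gt0.
  by rewrite ltn_neqAle f2 andbT; apply: contraTneq f_ge => <-; rewrite p3.
have [clW cW] := @inj_set3 _ _ (cl H) (x a) (x b) (x g) ba (aSc g gS) (bSc g gS).
apply: (key S e1 e2 [set a; b] [set x a; x b; x g] a b) => //.
- by move=> e; rewrite !inE => /orP[]/eqP->; rewrite eqxx ?orbT; auto.
- by rewrite !subUset !sub1set (xP a) // (xP b) //= imset_f // inE gS.
- move=> w; rewrite !inE => /orP[/orP[]|]/eqP-> //.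
  by have [] := inS g gS.
- by rewrite cW p3.
Qed.

(** Induction on the generation [H] at which all neighbours of a [y]-vertex agree. At [H = 0] they
    coincide, and a vertex of the core carries [m] parallel edges, with nothing to mark. *)
Lemma dense_layer H A :
  A != set0 -> {in A &, forall e e', y e = y e' -> cl H (x e) = cl H (x e')} ->
  m.+3 * (m.+3).*2 ^ H * (#|x @: A| + #|y @: A|) <= #|A| ->
  p * H.+1 <= m -> layer_config A H.
Proof.
elim: H A => [|H IH] A A0 clA le_A pHm.
  have [|B [BA /set0Pn[e eB] degB]] := @min_degree_core A m A0.
    by apply: leq_trans le_A; rewrite expn0 muln1 leq_mul // -addn3 leq_addr.
  pose B' := [set e' in B | y e' == y e].
  have [F FB' cF] : exists2 F : {set E}, F \subset B' & #|F| = m.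
    pose s := take m (enum B'); exists [set e' in s].
      by apply/subsetP => e'; rewrite inE => /mem_take; rewrite mem_enum.
    have us : uniq s by rewrite take_uniq // enum_uniq.
    rewrite cardsE (card_uniqP us) size_takel // -cardE.
    exact: (degB e eB).2.
  have inF e' : e' \in F -> e' \in A /\ y e' = y e.
    by move/(subsetP FB'); rewrite inE => /andP[/(subsetP BA)? /eqP].
  have xF e1 e2 : e1 \in F -> e2 \in F -> x e1 = x e2.
    move=> /inF[e1A y1] /inF[e2A y2]; apply: cl0_inj; apply: clA => //.
    by rewrite y1 y2.
  have other e' : e' \in F -> exists2 e'', e'' \in F & e'' != e'.
    move=> e'F; have : 0 < #|F :\ e'| by move: m1; rewrite -cF (cardsD1 e') e'F.
    by case/card_gt0P => e''; rewrite !inE => /andP[]; exists e''.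
  exists 0, F, set0; split.
  - by split=> //; apply/subsetP => e' /inF[].
  - by rewrite cards0 addn0.
  - by split=> u; rewrite inE.
  - by rewrite cards0 sub0set eqxx.
  - move=> e' e'F; have [e'' e''F ne] := other _ e'F.
    split; last by right; exists e''; split=> //; exact: xF.
    by exists e''; split=> //; have [_ ->] := inF _ e'F; have [_ ->] := inF _ e''F.
(* One generation costs [2 * K]: the 2 for keeping the larger of [poor] and [rich], the [K] for
   keeping one class per vertex. *)
pose K := m.+3; pose D := K * K.*2 ^ H.
have DE : m.+3 * (m.+3).*2 ^ H.+1 = 2 * (K * D).
  by rewrite expnS /D -muln2; lia.
rewrite DE in le_A.
pose poor := [set e in A | #|classes_at H A (y e)| < K].
pose rich := [set e in A | K <= #|classes_at H A (y e)|].
have [poorA richA] : poor \subset A /\ rich \subset A.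
  by split; apply/subsetP => e; rewrite inE => /andP[].
have cardA : #|A| = #|poor| + #|rich|.
  rewrite -(cardsID [set e | #|classes_at H A (y e)| < K] A); congr (_ + _).
    by apply: eq_card => e'; rewrite !inE.
  by apply: eq_card => e'; rewrite !inE andbC -leqNgt.
have sub_le (A' : {set E}) : A' \subset A -> #|A| <= 2 * #|A'| ->
    K * D * (#|x @: A'| + #|y @: A'|) <= #|A'| /\ A' != set0.
  move=> A'A le_A'; split.
    rewrite -(leq_pmul2l (isT : 0 < 2)) mulnA; apply: leq_trans le_A'.
    by apply: leq_trans le_A; rewrite leq_mul // leq_add // subset_leq_card // imsetS.
  rewrite -card_gt0; case: #|A'| le_A' => //; rewrite muln0 leqNgt.
  by rewrite card_gt0 A0.
have pHm' : p * H.+1 <= m by apply: leq_trans pHm; rewrite leq_mul2l leqnSn orbT.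
(* Either most edges lie at vertices seeing many classes, or keeping at each of the other vertices
   only its most popular class makes all neighbours agree one generation earlier. *)
have [le_pr|/ltnW le_rp] := leqP #|poor| #|rich|.
  have [|le_rich rich0] := sub_le rich richA.
    by rewrite cardA mul2n -addnn leq_add2r.
  have [|B [Brich B0 degB]] := @min_degree_core rich m rich0.
    apply: leq_trans le_rich; rewrite leq_mul // /D /K mulnA.
    apply: leq_trans (leq_pmulr _ _); last by rewrite expn_gt0.
    by nia.
  apply: (@rich_config _ _ B) => //; first exact: subset_trans richA.
  by move=> e /(subsetP Brich); rewrite inE => /andP[].
have [|le_poor poor0] := sub_le poor poorA.
  by rewrite cardA mul2n -addnn leq_add2l.
have sub_at e : classes_at H poor (y e) \subset classes_at H A (y e).
  apply/subsetP => c /imsetP[e']; rewrite inE => /andP[/(subsetP poorA) e'A ye] ->.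
  by apply: imset_f; rewrite inE e'A.
have [|A' [A'poor A'0 clA' le_A']] := @poor_config H poor K D poor0 _ le_poor.
  move=> e; rewrite inE => /andP[_ /ltnW]; apply: leq_trans.
  exact: subset_leq_card.
apply: layer_configS (leqnSn H) (IH _ A'0 clA' le_A' pHm').
exact: subset_trans A'poor poorA.
Qed.

End DenseBipartite.

(** * Levels of a breadth-first search *)

Section Layers.
Variables (E V : finType) (s t : E -> V) (side : V -> bool).
Hypotheses (side_s : forall e, side (s e) = false) (side_t : forall e, side (t e)).
Variables (B : {set E}) (e0 : E) (k : nat).
Hypothesis e0B : e0 \in B.
Let r := s e0.

Definition nbhd (A : {set V}) := [set v |
  [exists e in B, (s e == v) && (t e \in A) || (t e == v) && (s e \in A)]].

(** Ends of walks of length exactly [j], not at most [j], so that the parity of [j] tells the side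
    of the vertex. *)
Definition reach j := iter j nbhd [set r].

(* Distance to the root, truncated: vertices further than [k] get level [k.+1]. *)
Definition lev v := find (fun j => v \in reach j) (iota 0 k.+1).

Lemma lev_max v : lev v <= k.+1.
Proof. by rewrite -[k.+1 in X in _ <= X](size_iota 0) find_size. Qed.

Lemma reach_lev v : lev v <= k -> v \in reach (lev v).
Proof.
move=> le_k; have hasv : has (fun j => v \in reach j) (iota 0 k.+1).
  by rewrite has_find size_iota.
by have := nth_find 0 hasv; rewrite nth_iota.
Qed.

Lemma lev_reach v j : v \in reach j -> lev v <= j.
Proof.
move=> vj; rewrite leqNgt; apply/negP => lt_j.
have := before_find 0 lt_j; rewrite nth_iota ?vj //.
exact: leq_trans lt_j (lev_max v).
Qed.

Lemma side_reach v j : v \in reach j -> side v = odd j.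
Proof.
elim: j v => [|j IH] v; first by rewrite inE => /eqP->; exact: side_s.
rewrite inE => /exists_inP[e _ /orP[]/andP[/eqP<- /IH]] /=.
  by rewrite side_t side_s => <-.
by rewrite side_t side_s => <-.
Qed.

Lemma lev_adj e : e \in B -> lev (s e) <= (lev (t e)).+1 /\ lev (t e) <= (lev (s e)).+1.
Proof.
move=> eB; split.
  have [le_k|lt_k] := leqP (lev (t e)) k; last exact: leq_trans (lev_max _) (leqW lt_k).
  apply: lev_reach; rewrite inE; apply/exists_inP; exists e => //.
  by rewrite eqxx reach_lev.
have [le_k|lt_k] := leqP (lev (s e)) k; last exact: leq_trans (lev_max _) (leqW lt_k).
apply: lev_reach; rewrite inE; apply/exists_inP; exists e => //.
by rewrite eqxx reach_lev // orbT.
Qed.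

Lemma lev_neq e : lev (s e) <= k -> lev (s e) != lev (t e).
Proof.
move=> sk; apply/eqP => eq_lev.
have := side_reach (reach_lev sk); rewrite side_s eq_lev.
by rewrite -(side_reach (reach_lev _)) ?side_t // -eq_lev.
Qed.

(** [lo] and [hi] orient edges away from the root. Equal levels occur only at level [k.+1], and such
    an edge lies in no [layer]. *)
Definition lo e := if lev (s e) < lev (t e) then s e else t e.
Definition hi e := if lev (s e) < lev (t e) then t e else s e.

Lemma endsE e v : (lo e = v \/ hi e = v) <-> (s e = v \/ t e = v).
Proof. by rewrite /lo /hi; case: ifP => _; tauto. Qed.

Lemma lev_lo_hi e : e \in B -> lev (s e) <= k \/ lev (t e) <= k ->
  lev (hi e) = (lev (lo e)).+1.
Proof.
move=> eB le_k; have [st ts] := lev_adj eB.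
have ne : lev (s e) != lev (t e).
  have [/lev_neq//|lt_s] := leqP (lev (s e)) k.
  by case: le_k => [|le_t]; [rewrite leqNgt lt_s | rewrite gtn_eqF // (leq_ltn_trans le_t)].
rewrite /lo /hi; case: ltngtP ne => // lt _; apply/eqP; rewrite eqn_leq.
  by rewrite ts lt.
by rewrite st lt.
Qed.

Definition layer j := [set e in B | (lev (lo e) == j) && (lev (hi e) == j.+1)].

Definition level j := [set v | lev v == j].

Lemma lev0 v : lev v = 0 -> v = r.
Proof. by move=> v0; have := @reach_lev v; rewrite v0 inE => /(_ isT)/eqP. Qed.

Lemma parent_edge v : 0 < lev v <= k ->
  exists e, [/\ e \in B, hi e = v & (lev (lo e)).+1 = lev v].
Proof.
case/andP=> v0 vk; have := reach_lev vk.
rewrite -{1}(prednK v0) inE => /exists_inP[e eB] ev.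
have [st ts] := lev_adj eB; move: ev.
case/orP=> /andP[/eqP ve /lev_reach le_v].
  have lt_v : lev (t e) < lev v by rewrite -(prednK v0) ltnS.
  exists e; rewrite /lo /hi ve ltnNge (ltnW lt_v) /=; split=> //.
  by apply/eqP; rewrite eqn_leq lt_v -ve.
have lt_v : lev (s e) < lev v by rewrite -(prednK v0) ltnS.
exists e; rewrite /lo /hi ve lt_v /=; split=> //.
by apply/eqP; rewrite eqn_leq lt_v -ve.
Qed.

Lemma sum_fibers_le (f : E -> V) (A : {set E}) (L : {set V}) :
  \sum_(v in L) #|[set e in A | f e == v]| <= #|A|.
Proof.
rewrite -[X in _ <= X]sum1_card (partition_big f xpredT) //= [X in _ <= X](bigID (mem L)) /=.
rewrite (eq_bigr (fun v => \sum_(e in A | f e == v) 1)) ?leq_addr // => v _.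
by rewrite -sum1_card; apply: eq_bigl => e; rewrite inE.
Qed.

Variables (delta D q : nat).
Hypothesis degB : forall e, e \in B ->
  delta <= #|[set e' in B | s e' == s e]| /\ delta <= #|[set e' in B | t e' == t e]|.

Definition layer_below j := if j is i.+1 then layer i else set0.

(** An edge at a vertex of level [j] leads one level up or down, so one of the two adjacent layers
    counts it. *)
Lemma level_degree j : j <= k -> delta * #|level j| <= #|layer j| + #|layer_below j|.
Proof.
move=> jk; rewrite mulnC -sum_nat_const.
apply: leq_trans (leq_add (sum_fibers_le lo _ (level j)) (sum_fibers_le hi _ (level j))).
rewrite -big_split /=; apply: leq_sum => v; rewrite inE => /eqP vj.
have sub (A : {set E}) : (forall e, e \in A -> e \in B /\ (s e = v \/ t e = v)) ->
    #|A| <= #|[set e in layer j | lo e == v]| + #|[set e in layer_below j | hi e == v]|.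
  move=> inA; apply: leq_trans (leq_card_setU _ _).
  apply: subset_leq_card; apply/subsetP => e /inA[eB ev].
  have le_k : lev (s e) <= k \/ lev (t e) <= k by case: ev => ->; rewrite vj jk; auto.
  have lh := lev_lo_hi eB le_k.
  case/endsE: ev => ev; rewrite !inE ev eqxx andbT eB.
    by rewrite lh ev vj !eqxx.
  move: lh; rewrite ev vj; case: (j) vj => //= i vi [iE].
  by rewrite !inE ev eB vi iE !eqxx orbT.
have [e eB ev] : exists2 e, e \in B & s e = v \/ t e = v.
  have [v0|v0] := posnP (lev v); first by exists e0; rewrite // (lev0 v0); left.
  have [|e [eB he _]] := @parent_edge v; first by rewrite v0 vj.
  by exists e => //; apply/endsE; right.
case: ev => ev.
  apply: leq_trans (degB eB).1 (sub _ _) => e'; rewrite inE => /andP[-> /eqP->].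
  by rewrite ev; auto.
apply: leq_trans (degB eB).2 (sub _ _) => e'; rewrite inE => /andP[-> /eqP->].
by rewrite ev; auto.
Qed.

Hypotheses (D0 : 0 < D) (q0 : 0 < q) (qk : #|V| < q ^ k).
Hypothesis deltaE : delta = D * q.+3.

(* If every layer were sparse, the minimum degree would force each level to be [q] times as large as
   the previous one. *)
Lemma dense_layer_exists : exists2 j, j < k &
  layer j != set0 /\ D * (#|lo @: layer j| + #|hi @: layer j|) <= #|layer j|.
Proof.
have [/existsP[j /andP[j0 dj]]|/existsPn sparse] := boolP [exists j : 'I_k,
    (layer j != set0) && (D * (#|lo @: layer j| + #|hi @: layer j|) <= #|layer j|)].
  by exists j.
have layer_le j : j < k -> #|layer j| <= D * (#|level j| + #|level j.+1|).
  move=> jk; have := sparse (Ordinal jk); rewrite negb_and negbK /=.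
  case/orP=> [/eqP->|]; first by rewrite cards0.
  rewrite -ltnNge => /ltnW/leq_trans; apply; rewrite leq_mul // leq_add //;
    apply: subset_leq_card; apply/subsetP => _ /imsetP[e + ->];
    by rewrite !inE => /and3P[].
suff /(_ k (leqnn k)) [le_k _] : forall j, j <= k ->
    q ^ j <= #|level j| /\ #|layer_below j| <= 2 * D * #|level j|.
  by have := leq_trans qk (leq_trans le_k (max_card _)); rewrite ltnn.
elim=> [|j IH] jk.
  rewrite /= cards0; split=> //; apply/card_gt0P; exists r; rewrite inE -leqn0.
  by apply: lev_reach; rewrite inE.
have [le_j below_j] := IH (ltnW jk).
have := level_degree (ltnW jk); have := layer_le j jk; rewrite deltaE /=.
move: le_j below_j; rewrite expnS.
move: #|level j| #|level j.+1| #|layer j| #|layer_below j| (q ^ j) => a b M N Q.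
move=> Qa Na Mab qaMN.
(* The minimum degree gives [D * q.+3 * a <= M + N <= D * (a + b) + 2 * D * a]; the 3 in [q.+3]
   absorbs the terms in [a] on the right. *)
have qab : q * a <= b by rewrite -(leq_pmul2l D0); nia.
split; first by apply: leq_trans qab; rewrite leq_mul2l Qa orbT.
apply: leq_trans Mab _; have : a <= b by apply: leq_trans qab; rewrite leq_pmull.
by nia.
Qed.

(** A choice of search tree. The pick succeeds at levels from 1 to [k]; [e0] only makes the function
    total. *)
Definition pedge v := odflt e0 [pick e in B | (hi e == v) && ((lev (lo e)).+1 == lev v)].

Definition parent v := lo (pedge v).

Lemma pedgeP v : 0 < lev v <= k ->
  [/\ pedge v \in B, hi (pedge v) = v & (lev (parent v)).+1 = lev v].
Proof.
move=> /parent_edge[e [eB he le]]; rewrite /parent /pedge; case: pickP => /= [f|].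
  by case/and3P=> ? /eqP ? /eqP.
by move/(_ e); rewrite eB he le !eqxx.
Qed.

Lemma lev_anc h v : h <= lev v <= k -> lev (iter h parent v) = lev v - h.
Proof.
elim: h => [|h IH]; first by rewrite subn0.
case/andP=> hv vk; have anc := IH (introT andP (conj (ltnW hv) vk)).
have [|_ _] := @pedgeP (iter h parent v).
  by rewrite anc subn_gt0 hv (leq_trans (leq_subr _ _)).
by rewrite iterS anc => /eqP; rewrite -(subnSK hv) eqSS => /eqP.
Qed.

Lemma pedge_anc h v : h < lev v <= k ->
  pedge (iter h parent v) \in B /\ hi (pedge (iter h parent v)) = iter h parent v.
Proof.
case/andP=> hv vk; have [|pB hp _] := @pedgeP (iter h parent v); last by split.
by rewrite lev_anc ?vk ?(ltnW hv) // subn_gt0 hv (leq_trans (leq_subr _ _)).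
Qed.

Variables (p m : nat).
Hypothesis pm : (p == 2) && ~~ odd m || (p == 3).
Hypotheses (k0 : 0 < k) (pkm : p * k <= m).
Hypothesis DE : D = m.+3 * (m.+3).*2 ^ k.

(** Injectivity of the [h.-1]-th ancestor makes the paths from [W] to the common ancestor
    edge-disjoint, so they add exactly [#|W| * h] edges, all closer to the root than [F]. An inner
    vertex of a path has two path edges, a marked vertex an edge of [F] and a path edge, the common
    ancestor one edge from each path. *)
Lemma attach_tree j h (F : {set E}) (W : {set V}) :
  j < k -> h <= j -> F \subset layer j -> #|F| + #|W| * h = m ->
  {in W &, forall a b, iter h parent a = iter h parent b} ->
  {in W &, injective (iter h.-1 parent)} ->
  (W != set0 -> 0 < h) -> #|W| != 1 -> W \subset lo @: F ->
  (forall e, e \in F ->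
    (exists e', [/\ e' \in F, e' != e & hi e' = hi e]) /\
    (lo e \in W \/ exists e', [/\ e' \in F, e' != e & lo e' = lo e])) ->
  exists U : {set E}, #|U| = m /\ forall e v, e \in U -> lo e = v \/ hi e = v ->
    exists e', [/\ e' \in U, e' != e & lo e' = v \/ hi e' = v].
Proof.
move=> jk hj FM cF topW injW W0 W1 WF inF.
have levF e : e \in F -> lev (lo e) = j /\ lev (hi e) = j.+1.
  by move=> /(subsetP FM); rewrite inE => /and3P[_ /eqP-> /eqP->].
have levW w : w \in W -> lev w = j by move=> /(subsetP WF)/imsetP[e /levF[le _] ->].
have ancW i w : i <= h -> w \in W -> lev (iter i parent w) = j - i.
  by move=> ih wW; rewrite lev_anc levW // (leq_trans ih hj) ltnW.
have pW i w : i < h -> w \in W -> hi (pedge (iter i parent w)) = iter i parent w.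
  move=> ih wW; have [|_ //] := @pedge_anc i w.
  by rewrite levW // (leq_trans ih hj) ltnW.
have lopW i w : lo (pedge (iter i parent w)) = iter i.+1 parent w by [].
pose te (c : V * 'I_h) := pedge (iter c.2 parent c.1).
pose T := te @: setX W setT.
have inT e : e \in T -> exists w i, [/\ w \in W, i < h & e = pedge (iter i parent w)].
  by case/imsetP=> [[w i]]; rewrite !inE andbT => wW ->; exists w, i.
have TI w i : w \in W -> i < h -> pedge (iter i parent w) \in T.
  by move=> wW ih; apply/imsetP; exists (w, Ordinal ih); rewrite ?inE ?wW.
have neqT i i' w w' : i < h -> i' < h -> w \in W -> w' \in W -> i != i' ->
    pedge (iter i parent w) != pedge (iter i' parent w').
  move=> ih ih' wW wW' ii'; apply/eqP => /(congr1 (lev \o hi)) /=.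
  rewrite !pW // !ancW ?(ltnW ih) ?(ltnW ih') // => /eqP.
  by rewrite eqn_sub2lE ?(negPf ii') // (leq_trans (ltnW _) hj).
have inj_iter i w w' : i < h -> w \in W -> w' \in W ->
    iter i parent w = iter i parent w' -> w = w'.
  move=> ih wW wW' eq_i; apply: injW => //.
  have -> : h.-1 = (h.-1 - i) + i by rewrite subnK // -ltnS (ltn_predK ih).
  by rewrite !iterD eq_i.
have cT : #|T| = #|W| * h.
  rewrite card_in_imset; first by rewrite cardsX cardsT card_ord.
  move=> [w i] [w' i']; rewrite !inE !andbT /te /= => wW wW' eq_te.
  have [ii'|ne] := eqVneq i i'; last first.
    by have := neqT _ _ w w' (ltn_ord i) (ltn_ord i') wW wW' ne; rewrite eq_te eqxx.
  rewrite -ii' in eq_te *; congr pair.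
  by apply: (@inj_iter i) => //; rewrite -(pW _ _ (ltn_ord i) wW) eq_te pW.
have FT : F :&: T = set0.
  apply/eqP; rewrite -subset0; apply/subsetP => e; rewrite inE => /andP[/levF[_ he]].
  case/inT=> w [i [wW ih ee]]; move: he; rewrite ee pW // ancW ?(ltnW ih) //.
  by move=> ji; have := leq_subr i j; rewrite ji ltnn.
have neFT e e' : e \in F -> e' \in T -> e != e'.
  move=> eF; apply: contraTneq => <-; apply/negP => eT.
  by have /setP/(_ e) := FT; rewrite !inE eF eT.
exists (F :|: T); split; first by rewrite cardsU FT cards0 subn0 cT.
move=> e v; rewrite inE => /orP[eF|/inT[w [i [wW ih ee]]]].
  have [[e' [e'F ne he]] loe] := inF e eF; case=> <-; last first.
    by exists e'; rewrite inE e'F; split=> //; right.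
  case: loe => [loW|[e'' [e''F ne' le]]]; last first.
    by exists e''; rewrite inE e''F; split=> //; left.
  have h0 : 0 < h by apply: W0; apply/set0Pn; exists (lo e).
  exists (pedge (iter 0 parent (lo e))); split.
  - by rewrite inE TI ?orbT.
  - by rewrite eq_sym neFT // TI.
  - by right; rewrite pW.
have eT : e \in T by rewrite ee TI.
case=> <-; last first.
  rewrite ee pW //; case: i => [|i] in ih ee *.
    have /imsetP[f fF wf] := subsetP WF w wW.
    by exists f; rewrite inE fF -ee; split=> //; [exact: neFT | left; rewrite /= wf].
  exists (pedge (iter i parent w)); split; last by left.
    by rewrite inE TI ?orbT // ltnW.
  by rewrite neqT ?(ltnW ih) // ltn_eqF.
rewrite ee lopW.
have [lt_h|] := ltnP i.+1 h.
  exists (pedge (iter i.+1 parent w)); split.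
  - by rewrite inE TI ?orbT.
  - by rewrite neqT // gtn_eqF.
  - by right; rewrite pW.
move=> le_h; have hE : h = i.+1 by apply/eqP; rewrite eqn_leq le_h ih.
(* At the common ancestor the other edge comes from a second marked vertex. *)
have [w' ww'] : exists2 w', w' \in W & w' != w.
  have : 0 < #|W :\ w| by move: W1; rewrite (cardsD1 w) wW; case: #|_|.
  by case/card_gt0P=> w'; rewrite !inE => /andP[]; exists w'.
move=> ne; exists (pedge (iter i parent w')); split.
- by rewrite inE TI ?orbT.
- apply: contra_neq ne => eq_p; apply: (@inj_iter i) => //.
  by rewrite -[LHS](pW i w' ih ww') eq_p pW.
- by left; rewrite lopW -hE; apply: topW.
Qed.

Lemma layers_config : exists U : {set E}, #|U| = m /\ forall e, e \in U ->
  (exists e', [/\ e' \in U, e' != e & s e' = s e]) /\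
  (exists e', [/\ e' \in U, e' != e & t e' = t e]).
Proof.
have [j jk [M0 densej]] := dense_layer_exists.
have m1 : 1 < m.
  by apply: leq_trans pkm; case/orP: pm => [/andP[/eqP-> _]|/eqP->]; nia.
have levM e : e \in layer j -> lev (lo e) = j.
  by rewrite inE => /and3P[_ /eqP->].
have [|||h [F [W [[hj FM] cF [topW injW] [W0 W1 WF] inF]]]] :=
    @dense_layer _ _ _ lo hi _ (fun h => iter h parent) p m (fun a b => id) pm m1 j _ M0.
(* At generation [j] agreement is automatic: every vertex of level [j] descends from the root. *)
- move=> e e' eM e'M _.
  have root f : f \in layer j -> iter j parent (lo f) = r.
    by move=> /levM fj; apply: lev0; rewrite lev_anc fj ?subnn // leqnn ltnW.
  by rewrite !root.
- apply: leq_trans densej; rewrite DE leq_mul // leq_mul // leq_pexp2l // ltnW //.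
- by apply: leq_trans pkm; rewrite leq_mul2l jk orbT.
have [U [cU inU]] := attach_tree jk hj FM cF topW injW W0 W1 WF inF.
exists U; split=> // e eU; split.
  have [|e' [e'U ne /endsE e'v]] := inU e (s e) eU; first by apply/endsE; left.
  exists e'; split=> //; case: e'v => // te'.
  by have := side_t e'; rewrite te' side_s.
have [|e' [e'U ne /endsE e'v]] := inU e (t e) eU; first by apply/endsE; right.
exists e'; split=> //; case: e'v => // se'.
by have := side_s e'; rewrite se' side_t.
Qed.

End Layers.

(* [E] is viewed as a bipartite multigraph on two copies of [C]. *)
Lemma even_config (C E : finType) (x y : E -> C) (p m k q : nat) :
  (p == 2) && ~~ odd m || (p == 3) -> 0 < k -> p * k <= m -> 0 < #|E| ->
  #|C|.*2 < q ^ k -> m.+3 * (m.+3).*2 ^ k * q.+3 * #|C|.*2 <= #|E| ->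
  exists U : {set E}, #|U| = m /\ forall e, e \in U ->
    (exists e', [/\ e' \in U, e' != e & x e' = x e]) /\
    (exists e', [/\ e' \in U, e' != e & y e' = y e]).
Proof.
move=> pm k0 pkm E0 qk le_E.
pose D := m.+3 * (m.+3).*2 ^ k.
have [||B [_ /set0Pn[e0 e0B] degB]] := @min_degree_core _ _ _ x y setT (D * q.+3).
- by rewrite -card_gt0 cardsT.
- rewrite cardsT; apply: leq_trans le_E; rewrite leq_mul // -addnn.
  by rewrite leq_add // max_card.
have q0 : 0 < q by case: q qk {le_E degB} => //; rewrite exp0n.
have D0 : 0 < D by rewrite muln_gt0 /= expn_gt0.
have [||U [cU inU]] := @layers_config E (C + C)%type (fun e => inl (x e)) (fun e => inr (y e))
    (fun v => if v is inl _ then false else true) (fun=> erefl) (fun=> erefl)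
    B e0 k e0B (D * q.+3) D q _ D0 q0 _ erefl p m pm k0 pkm erefl.
- by move=> e /degB.
- by rewrite card_sum addnn.
exists U; split=> // e /inU[[e' [? ? [?]]] [e'' [? ? [?]]]].
by split; [exists e' | exists e''].
Qed.

(** * Pairs of consecutive points *)

Lemma leq_4half n : 1 < n -> n <= 4 * n./2.
Proof. lia. Qed.

Lemma pair_ltn n (e : 'I_n./2) : (e.*2.+1 < n).
Proof.
by rewrite (leq_trans (_ : _ <= n./2.*2)) // ?leq_double -?doubleS ?leq_double //
  -[X in (_ <= X)](odd_double_half n) leq_addl.
Qed.

Definition pair_snd n (e : 'I_n./2) : 'I_n := Ordinal (pair_ltn e).
Definition pair_fst n (e : 'I_n./2) : 'I_n := Ordinal (ltnW (pair_ltn e)).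

Definition pair_union n (U : {set 'I_n./2}) : {set 'I_n} :=
  @pair_fst n @: U :|: @pair_snd n @: U.

Lemma pair_fst_inj n : injective (@pair_fst n).
Proof. by move=> i j [/double_inj/val_inj]. Qed.

Lemma pair_snd_inj n : injective (@pair_snd n).
Proof. by move=> i j [/double_inj/val_inj]. Qed.

Lemma pair_disjoint n (U : {set 'I_n./2}) :
  [disjoint @pair_fst n @: U & @pair_snd n @: U].
Proof.
rewrite disjoint_subset; apply/subsetP => _ /imsetP[i _ ->]; rewrite inE.
by apply/negP => /imsetP[j _ [/(congr1 odd)]]; rewrite /= !odd_double.
Qed.

Lemma big_pair_union (T : Type) (idx : T) (op : Monoid.com_law idx) n
    (U : {set 'I_n./2}) (F : 'I_n -> T) :
  \big[op/idx]_(i in pair_union U) F i =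
  \big[op/idx]_(e in U) op (F (pair_fst e)) (F (pair_snd e)).
Proof.
rewrite (eq_bigl [predU @pair_fst n @: U & @pair_snd n @: U]); last first.
  by move=> i; rewrite !inE.
rewrite bigU ?pair_disjoint //= big_split /=.
by rewrite !big_imset //= => i j _ _; [exact: pair_snd_inj | exact: pair_fst_inj].
Qed.

Lemma card_pair_union n (U : {set 'I_n./2}) : #|pair_union U| = #|U|.*2.
Proof. by rewrite -sum1_card big_pair_union sum_nat_const muln2. Qed.

Require Import Defs.
From mathcomp Require Import all_boot all_order all_algebra lra.
From mathcomp Require Import all_classical all_reals all_analysis.

Import Order.TTheory GRing.Theory Num.Theory.
Import numFieldNormedType.Exports.

Local Open Scope classical_set_scope.
Local Open Scope ring_scope.

(** * Facets of cyclic polytopes *)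

Section CyclicFacets.
Variables (R : realType) (d : nat).
Implicit Types (A : set 'rV[R]_d) (a v w : 'rV[R]_d) (p : {poly R}).

Let dot v a : R := (v *m a^T) 0 0.

Lemma dotE v a : (v *m a^T) 0 0 = \sum_j v 0 j * a 0 j.
Proof. by rewrite mxE; apply: eq_bigr => j _; rewrite mxE. Qed.

Lemma dotN v a : dot v (- a) = - dot v a.
Proof. by rewrite /dot !dotE -sumrN; apply: eq_bigr => j _; rewrite mxE mulrN. Qed.

Lemma dotB v w a : dot (v - w) a = dot v a - dot w a.
Proof. by rewrite /dot mulmxBl mxE [X in _ + X]mxE. Qed.

Lemma dot_comb (s t : R) v w a : dot (s *: v + t *: w) a = s * dot v a + t * dot w a.
Proof.
rewrite /dot !dotE !mulr_sumr -big_split /=; apply: eq_bigr => j _.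
by rewrite !mxE mulrDl !mulrA.
Qed.

Lemma convexP A :
  (forall v w (t : R), A v -> A w -> 0 < t -> t < 1 -> A (t *: v + (1 - t) *: w)) ->
  @convex_set R 'rV[R]_d A.
Proof.
move=> cA; apply/convex_setW => v w vA wA t t0 t1.
by apply/mem_set; apply: cA => //; apply: set_mem.
Qed.

Lemma convex_hull_convex A v w (t : R) :
  convex_hull A v -> convex_hull A w -> 0 < t -> t < 1 ->
  convex_hull A (t *: v + (1 - t) *: w).
Proof.
move=> hv hw t0 t1 B [cB AB].
have [vB wB] := (hv B (conj cB AB), hw B (conj cB AB)).
exact/set_mem/(cB v w (Itv01 (ltW t0) (ltW t1)) (mem_set vB) (mem_set wB)).
Qed.

(** The points strictly below the hyperplane, together with the hull of the generators on it, form a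
    convex set containing [A], hence its hull. *)
Lemma convex_hull_face A a (b : R) : (forall v, A v -> dot v a <= b) ->
  (forall v, convex_hull A v -> dot v a <= b) /\
  [set v | convex_hull A v /\ dot v a = b] =
    convex_hull [set v | A v /\ dot v a = b].
Proof.
move=> leA; set Ab := [set v | A v /\ dot v a = b].
pose B := [set v | dot v a < b \/ dot v a = b /\ convex_hull Ab v].
have leB v : B v -> dot v a <= b by move=> [/ltW//|[->]].
have hullB : convex_hull A `<=` B.
  apply: smallest_sub; last first.
    move=> v vA; have := leA v vA; rewrite le_eqVlt => /orP[/eqP vb|]; last by left.
    by right; split=> //; apply: sub_gen_smallest.
  apply: convexP => v w t vB wB t0 t1; rewrite /B /= dot_comb.
  have t1' : 0 < 1 - t by rewrite subr_gt0.
  have bE : b = t * b + (1 - t) * b by rewrite -mulrDl addrC subrK mul1r.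
  case: vB => [vb|[vb vAb]].
    by left; rewrite bE ltr_leD // ?ltr_pM2l // ler_pM2l //; exact: leB.
  case: wB => [wb|[wb wAb]].
    by left; rewrite bE ler_ltD // ?ltr_pM2l // ler_pM2l //; rewrite vb.
  by right; rewrite vb wb -bE; split=> //; apply: convex_hull_convex.
split=> [v /hullB/leB //|]; apply/seteqP; split=> v.
  by move=> [/hullB[vb eb|[]//]]; move: vb; rewrite eb ltxx.
move=> vAb; split.
  by apply: sub_smallest2r vAb => [|w []//]; apply: convexP; exact: convex_hull_convex.
suff : convex_hull Ab `<=` [set v | dot v a = b] by exact.
apply: smallest_sub => [|w []//]; apply: convexP => u w t /= ub wb _ _.
by rewrite dot_comb ub wb -mulrDl addrC subrK mul1r.
Qed.

Lemma convex_hull1 v : convex_hull [set v] = [set v].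
Proof.
apply: smallest_id; apply: convexP => u w t -> -> _ _ /=.
by rewrite -scalerDl addrC subrK scale1r.
Qed.

Lemma convex_hull0 : convex_hull (set0 : set 'rV[R]_d) = set0.
Proof. by apply: smallest_id; apply: convexP. Qed.

(** Along the moment curve this functional is [p] minus its constant term, which becomes the offset
    of the hyperplane. *)
Definition poly_normal p : 'rV[R]_d := \row_(j < d) p`_j.+1.

Lemma dot_moment p (t : R) : (size p <= d.+1)%N ->
  dot (moment_curve d t) (poly_normal p) = p.[t] - p`_0.
Proof.
move=> sp; rewrite (horner_coef_wide t sp) big_ord_recl expr0 mulr1 [RHS]addrC addKr.
by rewrite /dot dotE; apply: eq_bigr => j _; rewrite !mxE mulrC.
Qed.

(** A linear relation between the differences is tested against polynomials of degree at most [d];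
    the product vanishing at all nodes but one isolates a single coefficient. *)
Lemma moment_aff_indep m (tau : 'I_m.+1 -> R) : (m <= d)%N -> injective tau ->
  aff_indep (fun i => moment_curve d (tau i)).
Proof.
move=> md tau_inj; apply: inj_row_free => u; set M := \matrix_(_ < _) _ => uM.
have vanish p : (size p <= d.+1)%N ->
    \sum_i u 0 i * (p.[tau (lift ord0 i)] - p.[tau ord0]) = 0.
  move=> sp; have := congr1 (fun w => (w *m (poly_normal p)^T) 0 0) uM.
  rewrite -mulmxA mul0mx [RHS]mxE mxE => uM0; rewrite -[RHS]uM0; apply: eq_bigr => i _.
  have -> : (M *m (poly_normal p)^T) i 0 =
      dot (moment_curve d (tau (lift ord0 i)) - moment_curve d (tau ord0)) (poly_normal p).
    by rewrite /dot !mxE; apply: eq_bigr => j _; rewrite !mxE.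
  by rewrite dotB !dot_moment // opprB addrA subrK.
apply/rowP => i; rewrite mxE.
pose p := \prod_(j in predC1 (lift ord0 i)) ('X - (tau j)%:P).
have sp : (size p <= d.+1)%N.
  by rewrite /p -big_enum size_prod_XsubC -cardE cardC1 card_ord.
have p0 j : j != lift ord0 i -> p.[tau j] = 0.
  by move=> ne; rewrite horner_prod (bigD1 j) //= hornerXsubC subrr mul0r.
have := vanish p sp; rewrite (bigD1 i) //= [p.[tau ord0]]p0 // subr0 big1 => [|j ji].
  rewrite addr0 => /eqP; rewrite mulf_eq0 => /orP[/eqP//|].
  rewrite horner_prod prodf_seq_eq0 => /hasP[j _ /andP[ne]].
  by rewrite hornerXsubC subr_eq0 (inj_eq tau_inj) eq_sym (negPf ne).
by rewrite !p0 ?subr0 ?mulr0 // (inj_eq lift_inj).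
Qed.

Lemma has_aff_dim_full A (pt : 'I_d.+1 -> 'rV[R]_d) :
  (forall i, A (pt i)) -> aff_indep pt -> has_aff_dim A d.
Proof.
move=> ptA ind; split; first by exists pt.
case=> q [_]; rewrite /aff_indep /row_free => /eqP rk.
by have := rank_leq_col (\matrix_(i < d.+1) (q (lift ord0 i) - q ord0)); rewrite rk ltnn.
Qed.

End CyclicFacets.

Lemma has_aff_dim_hyperplane (R : realType) (d : nat) (A : set 'rV[R]_d.+1)
    (pt : 'I_d.+1 -> 'rV[R]_d.+1) (a : 'rV[R]_d.+1) (b : R) :
  (forall i, A (pt i)) -> aff_indep pt -> a != 0 ->
  (forall v, A v -> (v *m a^T) 0 0 = b) -> has_aff_dim A d.
Proof.
move=> ptA ind a0 Ab; split; first by exists pt.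
case=> q [qA]; rewrite /aff_indep; set M := \matrix_(_ < _) _ => freeM.
have Ma : M *m a^T = 0.
  apply/colP => i; rewrite [RHS]mxE.
  have -> : (M *m a^T) i 0 = ((q (lift ord0 i) - q ord0) *m a^T) 0 0.
    by rewrite !mxE; apply: eq_bigr => j _; rewrite !mxE.
  by rewrite mulmxBl mxE [X in _ + X]mxE !Ab // subrr.
move: freeM; rewrite row_free_unit => Mu.
by move: a0; rewrite -(trmxK a) -(mulKmx Mu a^T) Ma mulmx0 trmx0 eqxx.
Qed.

(* One half of Gale's criterion: nonnegativity of the polynomial vanishing on [S] makes it a
   supporting functional. *)
Lemma facet_hypergraph_nonneg (R : realType) (d n : nat) (S : {set 'I_n}) :
  (1 < d < n)%N -> #|S| = d ->
  (forall i : 'I_n, 0 <= \prod_(j in S) (i.+1%:R - j.+1%:R : R)) ->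
  facet_hypergraph R d n S.
Proof.
case: d => // d /andP[d1 dn] cS pos.
pose cv := @cyclic_vertex R d.+1 n.
pose P : {poly R} := \prod_(j in S) ('X - j.+1%:R%:P).
have sP : (size P <= d.+2)%N by rewrite /P -big_enum size_prod_XsubC -cardE cS.
have PE (i : 'I_n) : P.[i.+1%:R] = \prod_(j in S) (i.+1%:R - j.+1%:R).
  by rewrite horner_prod; apply: eq_bigr => j _; rewrite hornerXsubC.
have P0 (i : 'I_n) : (P.[i.+1%:R] == 0) = (i \in S).
  rewrite PE; apply/prodf_eq0/idP => [[j jS]|iS]; last by exists i; rewrite // subrr.
  by rewrite subr_eq0 eqr_nat eqSS => /eqP/val_inj ->.
(* A polynomial nonnegative on [T] supports the hull of [T] and touches it at its zeros. This is
   applied to [P] on all vertices and to a square on [S]. *)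
have expose (p : {poly R}) (T : set 'I_n) : (size p <= d.+2)%N ->
    (forall i, T i -> 0 <= p.[i.+1%:R]) ->
    (forall v, convex_hull (cv @` T) v -> (v *m (- poly_normal d.+1 p)^T) 0 0 <= p`_0) /\
    [set v | convex_hull (cv @` T) v /\ (v *m (- poly_normal d.+1 p)^T) 0 0 = p`_0] =
      convex_hull (cv @` [set i | T i /\ p.[i.+1%:R] = 0]).
  move=> sp pT; have dotP i : (cv i *m (- poly_normal d.+1 p)^T) 0 0 = p`_0 - p.[i.+1%:R].
    by rewrite dotN dot_moment // opprB.
  have [|le_hull ->] := @convex_hull_face R d.+1 (cv @` T) (- poly_normal d.+1 p) p`_0.
    by move=> _ [i Ti <-]; rewrite dotP gerBl pT.
  split=> //; congr convex_hull; apply/seteqP; split=> v /=.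
    move=> [[i Ti <-]]; rewrite dotP => /eqP.
    by rewrite subr_eq addrC -subr_eq subrr => /eqP pi; exists i.
  by move=> [i [Ti pi] <-]; split; [exists i | rewrite dotP pi subr0].
have posP (i : 'I_n) : 0 <= P.[i.+1%:R] by rewrite PE.
have [leP faceP] := expose P setT sP (fun i _ => posP i).
have SE : [set i : 'I_n | setT i /\ P.[i.+1%:R] = 0] = [set` S].
  apply/seteqP; split=> i /=; first by move=> [_ /eqP]; rewrite P0.
  by move=> iS; split=> //; apply/eqP; rewrite P0.
rewrite SE in faceP; set a := - _ in leP faceP; pose F := convex_hull (cv @` [set` S]).
have FP v : F v -> convex_hull (range cv) v /\ (v *m a^T) 0 0 = P`_0.
  by rewrite /F -faceP.
have inF i : i \in S -> F (cv i) by move=> iS; apply: sub_gen_smallest; exists i.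
exists F; last first.
  apply/seteqP; split=> [v [c [b [le_b Fv]]]|_ [i iS <-]].
    have Fv' : F v /\ (v *m c^T) 0 0 = b by have : [set v] v by []; rewrite Fv.
    have [|_ vE] := @convex_hull_face R d.+1 (cv @` [set` S]) c b.
      by move=> _ [i iS <-]; apply: le_b; exact: inF.
    have [w [[i iS <-] wb]] : [set w | (cv @` [set` S]) w /\ (w *m c^T) 0 0 = b] !=set0.
      apply/set0P/eqP => e0; move: Fv'; rewrite -/(F v) => Fv'.
      have : [set v | convex_hull (cv @` [set` S]) v /\ (v *m c^T) 0 0 = b] v by [].
      by rewrite vE e0 convex_hull0.
    have : [set v] (cv i) by rewrite Fv; split=> //; exact: inF.
    by move=> <-; exists i.
  (* The double root at [i] exposes this vertex alone; degree two is available because the dimension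
     exceeds one. *)
  pose p : {poly R} := ('X - i.+1%:R%:P) ^+ 2.
  have sp : (size p <= d.+2)%N by rewrite size_exp_XsubC ltnS.
  have [|le_p face_p] := expose p [set` S] sp.
    by move=> j _; rewrite horner_exp sqr_ge0.
  exists (- poly_normal d.+1 p), p`_0; split=> //.
  rewrite face_p (_ : [set j | _] = [set i]) ?image_set1 ?convex_hull1 //.
  apply/seteqP; split=> j /=.
    move=> [_ /eqP]; rewrite horner_exp sqrf_eq0 hornerXsubC subr_eq0 eqr_nat eqSS.
    by move/eqP/val_inj.
  by move=> ->; split=> //; rewrite horner_exp hornerXsubC subrr expr0n.
split; first by exists a, P`_0; split=> //; rewrite faceP.
exists d; split.
  apply: (@has_aff_dim_full R d.+1 _ (fun i => cv (widen_ord dn i))).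
    by move=> i; apply: sub_gen_smallest; exists (widen_ord dn i).
  apply: (@moment_aff_indep R d.+1 d.+1 (fun i => i.+1%:R)) => // i j /eqP.
  by rewrite eqr_nat eqSS => /eqP/val_inj.
pose pt (i : 'I_d.+1) : 'I_n := enum_val (cast_ord (esym cS) i).
apply: (@has_aff_dim_hyperplane R d F (cv \o pt) a P`_0).
- by move=> i; apply: inF; exact: enum_valP.
- apply: (@moment_aff_indep R d.+1 d (fun i => (pt i).+1%:R)) => // i j /eqP.
  by rewrite eqr_nat eqSS => /eqP/val_inj/enum_val_inj/cast_ord_inj.
(* A zero normal would make [P] constant on the vertices, but it vanishes exactly on [S], which is
   neither empty nor everything. *)
- have [i iS] : exists i, i \notin S.
    apply/existsP; rewrite -negb_forall; apply/negP => /forallP allS.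
    have : #|'I_n| = #|S| by apply: eq_card => i; rewrite allS.
    by rewrite cS card_ord => nd; rewrite nd ltnn in dn.
  apply: contraNneq iS => a0; rewrite -P0.
  have /card_gt0P[j jS] : (0 < #|S|)%N by rewrite cS.
  have cst (i0 : 'I_n) : P.[i0.+1%:R] = P`_0.
    have := dot_moment i0.+1%:R sP; have /eqP := a0; rewrite oppr_eq0 => /eqP ->.
    by rewrite trmx0 mulmx0 mxE => /esym/eqP; rewrite subr_eq0 => /eqP.
  by rewrite cst -(cst j) P0.
- by move=> v /FP[].
Qed.

(** Each pair contributes the product of the differences to two consecutive integers, which is
    nonnegative at every integer. *)
Lemma pair_union_facet (R : realType) (n m : nat) (U : {set 'I_n./2}) :
  (0 < m)%N -> (m.*2 < n)%N -> #|U| = m -> facet_hypergraph R m.*2 n (pair_union U).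
Proof.
move=> m0 mn cU; apply: facet_hypergraph_nonneg.
- by rewrite mn andbT -(leq_double 1) in m0 *.
- by rewrite card_pair_union cU.
move=> i; rewrite big_pair_union /=; apply: prodr_ge0 => e _.
have [le_ie|lt_ei] := leqP i (e.*2)%N.
  by rewrite mulr_le0 // subr_le0 ler_nat ltnS // ltnW.
by rewrite mulr_ge0 // subr_ge0 ler_nat ltnS // ltnW.
Qed.

(** * The lower bound *)

Definition density (m k : nat) : nat := (m.+3 * m.+3.*2 ^ k)%N.

(** Otherwise [even_config] yields [m] pairs in which every first point shares its colour with
    another first point, and every second point with another second point; their union is a facet
    that violates conflict-freeness. *)
Lemma chi_FC_bound (R : realType) (p m k n q : nat) :
  (p == 2%N) && ~~ odd m || (p == 3%N) -> (0 < k)%N -> (p * k <= m)%N -> (m.*2 < n)%N ->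
  ((chi_FC R m.*2 n).*2 < q ^ k)%N ->
  (n./2 < density m k * q.+3 * (chi_FC R m.*2 n).*2)%N.
Proof.
move=> pm k0 pkm mn; rewrite /chi_FC /cf_chromatic_number.
case: ex_minnP => c /asboolP[phi cf_phi] _ qk; rewrite ltnNge; apply/negP => le_n.
have m0 : (0 < m)%N.
  by apply: leq_trans pkm; rewrite muln_gt0 k0 andbT; case/orP: pm => [/andP[/eqP-> _]|/eqP->].
have n0 : (0 < n./2)%N by rewrite half_gt0; apply: leq_trans mn; rewrite ltnS double_gt0.
have [|||U [cU inU]] := @even_config 'I_c 'I_n./2 (phi \o @pair_fst n) (phi \o @pair_snd n)
    p m k q pm k0 pkm _ _ _.
- by rewrite card_ord.
- by rewrite card_ord.
- by rewrite !card_ord.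
have [|v vU uniq_v] := cf_phi _ (pair_union_facet R m0 mn cU).
  have /card_gt0P[e eU] : (0 < #|U|)%N by rewrite cU.
  by apply/set0Pn; exists (pair_fst e); rewrite inE imset_f.
case/setUP: vU => /imsetP[e eU ve].
  have [[e' [e'U ne eq_phi]] _] := inU e eU.
  apply: (uniq_v (pair_fst e')); rewrite ?ve ?(inj_eq (@pair_fst_inj n)) //.
  by rewrite inE imset_f.
have [_ [e' [e'U ne eq_phi]]] := inU e eU.
apply: (uniq_v (pair_snd e')); rewrite ?ve ?(inj_eq (@pair_snd_inj n)) //.
by rewrite inE imset_f ?orbT.
Qed.

Lemma chi_FC_Omega (R : realType) (p m k : nat) :
  (p == 2%N) && ~~ odd m || (p == 3%N) -> (0 < k)%N -> (p * k <= m)%N ->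
  (fun n : nat => (chi_FC R m.*2 n)%:R : R^o)
    \is 'Omega_\oo (fun n : nat => n%:R `^ (k%:R / (k + 1)%:R) : R^o).
Proof.
move=> pm k0 pkm; rewrite qualifE; apply/asboolP.
pose K : R := (density m k)%:R.
have K1 : 1 <= K by rewrite ler1n muln_gt0 expn_gt0.
(* The 40 is [4 * 5 * 2], from [n <= 4 * n./2], [q.+3 <= 5 * x] and the two copies of the colour
   set. *)
exists (40 * K)^-1; first by rewrite invr_gt0; lra.
near=> n.
have mn : (m.*2 < n)%N by near: n; exact: nbhs_infty_gt.
have n2 : (2 <= n)%N by near: n; exact: nbhs_infty_ge.
rewrite normr_nat ger0_norm ?powR_ge0 // leNgt; apply/negP.
set c := chi_FC _ _ _ => lt_c.
pose x : R := n%:R `^ ((k + 1)%:R)^-1.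
have xk : n%:R `^ (k%:R / (k + 1)%:R) = x ^+ k.
  by rewrite -powR_mulrn ?powR_ge0 // -powRrM mulrC.
have xk1 : x ^+ k.+1 = n%:R.
  by rewrite -powR_mulrn ?powR_ge0 // -powRrM addn1 mulVf ?pnatr_eq0 // powRr1.
have x1 : 1 <= x.
  by rewrite -(@ler_pXn2r _ k.+1) ?nnegrE ?powR_ge0 // xk1 expr1n ler1n ltnW.
rewrite xk in lt_c.
(* The least integer above [x]: then [2 * c < x ^+ k <= q ^ k], while [q] is at most [x + 1]. *)
pose q := (Num.trunc x).+1.
have x_q : x < q%:R by exact: truncnS_gt.
have q_x : q%:R <= x + 1.
  by rewrite /q -natr1 lerD2r truncn_le; lra.
have xk_ge1 : 1 <= x ^+ k by rewrite exprn_ege1.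
have lt_c' : 40 * K * c%:R < x ^+ k.
  by rewrite mulrC -ltr_pdivlMr; [rewrite mulrC | lra].
have c0 : 0 <= c%:R :> R by [].
have cK : c%:R <= K * c%:R by rewrite ler_peMl.
have qk : (c.*2 < q ^ k)%N.
  rewrite -(ltr_nat R) -muln2 natrM natrX; apply: (@lt_le_trans _ _ (x ^+ k)); first lra.
  by rewrite lerXn2r ?nnegrE //; lra.
have := chi_FC_bound pm k0 pkm mn qk; rewrite -/c -muln2 -(ltr_nat R).
rewrite natrM (natrM _ (density m k)) (natrM _ c) -/K.
apply/negP; rewrite -leNgt.
have le_n : n%:R <= 4 * (n./2)%:R :> R.
  by rewrite -(natrM _ 4) ler_nat leq_4half.
have q3 : q.+3%:R <= 5 * x :> R.
  by rewrite -(addn3 q) natrD; lra.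
have : K * q.+3%:R * (c%:R * 2) <= 5 * x * (2 * (K * c%:R)).
  have -> : K * q.+3%:R * (c%:R * 2) = q.+3%:R * (2 * (K * c%:R)) by lra.
  by rewrite ler_wpM2r // mulr_ge0 // mulr_ge0 //; lra.
move/le_trans; apply.
have -> : 5 * x * (2 * (K * c%:R)) = x * (40 * K * c%:R) / 4 by lra.
rewrite ler_pdivrMr // [leRHS]mulrC; apply: le_trans le_n.
by rewrite -xk1 exprS ler_wpM2l //; lra.
Unshelve. all: by end_near. Qed.

Theorem theorem1p3 (R : realType) :
  (forall d : nat, ~~ odd d -> (4 <= d)%N ->
    (fun n : nat => (chi_FC R d n)%:R : R^o)
      \is 'Omega_\oo (fun n : nat => Num.sqrt n%:R : R^o))
  /\
  (forall k d : nat, (0 < k)%N -> d = (4 * k)%N ->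
    (fun n : nat => (chi_FC R d n)%:R : R^o)
      \is 'Omega_\oo (fun n : nat => n%:R `^ (d%:R / (d + 4)%:R) : R^o)
    /\
    (fun n : nat => (chi_FC R d n)%:R : R^o)
      \is 'Omega_\oo (fun n : nat => n%:R `^ (k%:R / (k + 1)%:R) : R^o))
  /\
  (forall d : nat, ~~ odd d -> (14 <= d)%N -> odd (d %/ 2) ->
    let kstar := (d %/ 6)%N in
    (fun n : nat => (chi_FC R d n)%:R : R^o)
      \is 'Omega_\oo (fun n : nat => n%:R `^ (kstar%:R / (kstar + 1)%:R) : R^o)).
Proof.
have dE d : ~~ odd d -> d = d./2.*2 by move=> /even_halfK.
split; [|split].
- move=> d d_even d4; rewrite (dE d d_even).
  have -> : (fun n : nat => Num.sqrt n%:R : R^o) =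
      (fun n : nat => n%:R `^ (1%:R / (1 + 1)%:R) : R^o).
    by apply/funext => n; rewrite -powR12_sqrt // div1r.
  have m2 : (2 <= d./2)%N := half_leq d4.
  (* The square root is the case [k = 1]; an odd [d./2] is at least three, as [p = 3] requires. *)
  have [m_odd|m_even] := boolP (odd d./2); last first.
    by apply: (@chi_FC_Omega R 2); rewrite ?m_even ?muln1.
  apply: (@chi_FC_Omega R 3) => //; rewrite muln1.
  by move: m2; rewrite leq_eqVlt => /orP[/eqP m2|//]; rewrite -m2 in m_odd.
- move=> k d k0 dk.
  have -> : d = (2 * k).*2 by rewrite dk -mul2n mulnA.
  have Ok : (fun n : nat => (chi_FC R (2 * k).*2 n)%:R : R^o)
      \is 'Omega_\oo (fun n : nat => n%:R `^ (k%:R / (k + 1)%:R) : R^o).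
    by apply: (@chi_FC_Omega R 2); rewrite // oddM.
  split=> //.
  have -> : (fun n : nat => n%:R `^ ((2 * k).*2%:R / ((2 * k).*2 + 4)%:R) : R^o) =
      (fun n : nat => n%:R `^ (k%:R / (k + 1)%:R) : R^o).
    apply/funext => n; congr (_ `^ _).
    have -> : ((2 * k).*2 + 4 = 4 * (k + 1))%N by rewrite -mul2n mulnDr mulnA.
    by rewrite -mul2n mulnA (natrM _ 4 k) (natrM _ 4 (k + 1)) -mulf_div divff ?mul1r.
  exact: Ok.
(* Here [p = 3], and [d %/ 6] is the largest [k] with [3 * k <= d./2]. *)
move=> d d_even d14 m_odd /=; have := @chi_FC_Omega R 3 d./2 (d %/ 6).
rewrite -(dE d d_even); apply=> //.
  by rewrite divn_gt0 // (leq_trans _ d14).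
have -> : (d %/ 6 = d./2 %/ 3)%N by rewrite -divn2 -divnMA.
by rewrite mulnC leq_trunc_div.
Qed.
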